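(* Consider the feedback integrator implemented with Euler's method, $x_{k+1}=x_k+h\bigl(f(x_k)-\alpha\nabla V(x_k)\bigr)$ with step size $h>0$ and gain $\alpha>0$, and fix $\varepsilon\in(0,\nu)$. (i) For every $\beta\in\left(0,\frac{2}{L}\right)$ there exists $h_\beta>0$ such that, for every $0<h<h_\beta$, the gain $\alpha=\frac{\beta}{h}$ satisfies $U^\varepsilon_{h,\alpha}\subseteq U^\varepsilon$, and therefore $U^\varepsilon_{h,\alpha}=U^\varepsilon$. Consequently, $U^\varepsilon$ is positively invariant under the Euler-discretized system with $\alpha=\frac{\beta}{h}$. (ii) If $h>0$ and $\alpha>0$ satisfy $U^\varepsilon_{h,\alpha}\subseteq U^\varepsilon$ and $\beta=h\alpha$, then for each $x\in U^\varepsilon$ the Taylor-based upper bound $$V(x)+\left(-\beta+\frac{L}{2}\beta^2\right)|\nabla V(x)|^2+\frac{h^2L}{2}|f(x)|^2,$$ regarded as a function of $\beta$ with $x$ and $h$ fixed, is minimized at $\beta=\frac1L$, i.e. $\alpha=\frac{1}{hL}$. Moreover, for all sufficiently small $h>0$ the gain $\alpha=\frac1{hL}$ is admissible, i.e. satisfies $U^\varepsilon_{h,\alpha}\subseteq U^\varepsilon$; thus for such $h$ it minimizes the Taylor-based upper bound among all admissible gains.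
   Context: Setting. $M$ is a smooth manifold embedded in $\mathbb R^n$, and $\dot x=f(x)$, $x(0)=x_I\in M$, is a dynamical system on $M$ whose solutions on $M$ exist globally and which admits first integrals $f_1,\dots,f_\ell:M\to\mathbb R$. The vector field $f$ and the functions $f_j$ are assumed to extend smoothly to an open neighborhood $U\subset\mathbb R^n$ of $M$ (same symbols for the extensions, so $f:U\to\mathbb R^n$). Put $\Lambda=\{x\in U: x\in M,\ f_j(x)=f_j(x_I),\ j=1,\dots,\ell\}$. $V:U\to\mathbb R_{\ge 0}$ is an analytic function with $V^{-1}(0)=\Lambda$ such that: (A1) $\langle\nabla V(x),f(x)\rangle=0$ for all $x\in U$; (A2) $\nu>0$ is such that $V^{-1}([0,\nu])\subseteq U$ is compact; (A3) all critical points of $V$ in $V^{-1}([0,\nu])$ lie in $V^{-1}(0)$. For $\varepsilon>0$ write $U^\varepsilon:=V^{-1}([0,\varepsilon])$. $|\cdot|$ is the Euclidean norm and $\|\cdot\|$ the matrix 2-norm. For the fixed $\varepsilon$, put $L:=\sup_{x\in U^\varepsilon}\|\nabla^2V(x)\|$, and for $h,\alpha>0$ put $$U^\varepsilon_{h,\alpha}:=\{x+t\,h(f(x)-\alpha\nabla V(x)):\ x\in U^\varepsilon,\ t\in[0,1]\}.$$ A gain $\alpha$ is called admissible (for $h$) if $U^\varepsilon_{h,\alpha}\subseteq U^\varepsilon$. The displayed expression in (ii) is the upper bound for $V\bigl(x+hf(x)-\beta\nabla V(x)\bigr)$, $x\in U^\varepsilon$, given by Taylor's theorem when $\alpha=\beta/h$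 is admissible. Positive invariance of a set means that the one-step map sends it into itself. *)

(* Defs.v *)
(* MathComp-Analysis.  Points of R^n are row vectors.  The library's norm on
   'rV[R]_n is the sup norm; it is used only for the topology and for
   derivatives, and every norm in a formula is the Euclidean [enorm]. *)
From HB Require Import structures.
From mathcomp Require Import all_boot all_order all_algebra.
From mathcomp Require Import all_classical all_reals all_analysis.

Set Implicit Arguments.
Unset Strict Implicit.
Unset Printing Implicit Defensive.

Import Order.TTheory GRing.Theory Num.Theory.
Import numFieldNormedType.Exports.

Local Open Scope classical_set_scope.
Local Open Scope ring_scope.

Definition dotv (R : realType) (n : nat) (u v : 'rV[R]_n) : R :=
  \sum_(i < n) u 0 i * v 0 i.

Definition enorm (R : realType) (n : nat) (u : 'rV[R]_n) : R :=
  Num.sqrt (dotv u u).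

(* The 2-norm of the linear map with matrix A; as vectors are rows, the image
   of u is u *m A^T. *)
Definition mx2norm (R : realType) (n : nat) (A : 'M[R]_n) : R :=
  sup [set enorm (u *m A^T) | u in [set u : 'rV[R]_n | enorm u <= 1]].

Definition grad (R : realType) (n : nat) (V : 'rV[R]_n -> R) (x : 'rV[R]_n) :
    'rV[R]_n :=
  \row_i 'D_(delta_mx 0 i) V x.

Definition hessian (R : realType) (n : nat) (V : 'rV[R]_n -> R)
    (x : 'rV[R]_n) : 'M[R]_n :=
  \matrix_(i, j) 'D_(delta_mx 0 i) ('D_(delta_mx 0 j) V) x.

(* C^k on an open set U, for functions given as total functions whose values
   outside U are irrelevant. *)
Fixpoint Ck_on (R : realType) (n : nat) (W : normedModType R) (k : nat)
    (U : set 'rV[R]_n) (g : 'rV[R]_n -> W) : Prop :=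
  match k with
  | 0 => forall x, U x -> {for x, continuous g}
  | k'.+1 => (forall x, U x -> differentiable g x) /\
             (forall v, Ck_on k' U ('D_v g))
  end.

Definition smooth_on (R : realType) (n : nat) (W : normedModType R)
    (U : set 'rV[R]_n) (g : 'rV[R]_n -> W) : Prop :=
  forall k, Ck_on k U g.

(* The sum of the monomials c_m y^m over the multi-indices m with all
   components < k. *)
Definition mpartial (R : realType) (n : nat) (c : {ffun 'I_n -> nat} -> R)
    (y : 'rV[R]_n) (k : nat) : R :=
  \sum_(m : {ffun 'I_n -> 'I_k})
    c [ffun i => m i : nat] * \prod_(i < n) y 0 i ^+ m i.

(* Real analyticity: smooth, and near each point of U the sum of a power series
   in n variables.  The series is required to converge absolutely, so the order
   of summation (here, by boxes of multi-indices) does not matter. *)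
Definition analytic_on (R : realType) (n : nat) (U : set 'rV[R]_n)
    (V : 'rV[R]_n -> R) : Prop :=
  smooth_on U V /\
  forall a, U a -> exists c : {ffun 'I_n -> nat} -> R,
    \forall x \near a,
      cvgn (mpartial (fun m => `|c m|) (\row_i `|(x - a) 0 i|)) /\
      mpartial c (x - a) @ \oo --> V x.

(* Embedded smooth submanifold of R^n of codimension m: locally the zero set of
   m smooth functions with linearly independent gradients. *)
Definition submanifold (R : realType) (n m : nat) (M : set 'rV[R]_n) : Prop :=
  forall p, M p -> exists (W : set 'rV[R]_n) (g : 'I_m -> 'rV[R]_n -> R),
    [/\ open W /\ W p,
        forall i, smooth_on W (g i),
        forall x, W x -> row_free (\matrix_(i < m) grad (g i) x) &
        M `&` W = [set x | W x /\ forall i, g i x = 0]].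

Definition tangent (R : realType) (n : nat) (M : set 'rV[R]_n)
    (x v : 'rV[R]_n) : Prop :=
  exists gamma : R -> 'rV[R]_n,
    [/\ \forall t \near (0 : R), M (gamma t), gamma 0 = x &
        is_derive (0 : R) 1 gamma v].

(* gamma is a solution of x' = f x on M for all t >= 0; its values at negative
   times are irrelevant. *)
Definition global_solution (R : realType) (n : nat) (M : set 'rV[R]_n)
    (f : 'rV[R]_n -> 'rV[R]_n) (gamma : R -> 'rV[R]_n) : Prop :=
  [/\ forall t, 0 <= t -> M (gamma t),
      {within `[0, +oo[, continuous gamma} &
      forall t : R, 0 < t -> is_derive t 1 gamma (f (gamma t))].

Definition first_integral (R : realType) (n : nat) (M : set 'rV[R]_n)
    (f : 'rV[R]_n -> 'rV[R]_n) (F : 'rV[R]_n -> R) : Prop :=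
  forall gamma, global_solution M f gamma ->
    forall t, 0 <= t -> F (gamma t) = F (gamma 0).

(* V^-1([0, c]) for V of domain U. *)
Definition sublevel (R : realType) (n : nat) (U : set 'rV[R]_n)
    (V : 'rV[R]_n -> R) (c : R) : set 'rV[R]_n :=
  U `&` V @^-1` `[0, c].

(* The set has an upper bound as soon as [sublevel U V c] is compact and V is
   C^2 on the open set U, so this [sup] is then a genuine supremum. *)
Definition hess_sup (R : realType) (n : nat) (U : set 'rV[R]_n)
    (V : 'rV[R]_n -> R) (c : R) : R :=
  sup [set mx2norm (hessian V x) | x in sublevel U V c].

Definition euler_step (R : realType) (n : nat) (f : 'rV[R]_n -> 'rV[R]_n)
    (V : 'rV[R]_n -> R) (h alpha : R) (x : 'rV[R]_n) : 'rV[R]_n :=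
  x + h *: (f x - alpha *: grad V x).

Definition euler_sweep (R : realType) (n : nat) (f : 'rV[R]_n -> 'rV[R]_n)
    (V : 'rV[R]_n -> R) (S : set 'rV[R]_n) (h alpha : R) : set 'rV[R]_n :=
  [set y | exists x t, [/\ S x, 0 <= t <= 1 &
             y = x + (t * h) *: (f x - alpha *: grad V x)]].

Definition positively_invariant (T : Type) (S : set T) (phi : T -> T) : Prop :=
  forall x, S x -> S (phi x).

Definition taylor_bound (R : realType) (n : nat) (f : 'rV[R]_n -> 'rV[R]_n)
    (V : 'rV[R]_n -> R) (L h : R) (x : 'rV[R]_n) (beta : R) : R :=
  V x + (- beta + L / 2 * beta ^+ 2) * enorm (grad V x) ^+ 2
      + h ^+ 2 * L / 2 * enorm (f x) ^+ 2.

(* Main.v *)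
(* Write s = h f(x) - b grad V(x) with b = h alpha.  Since grad V and f are
   orthogonal, Taylor's theorem along the part of the segment x + [0, T] s lying
   in U^eps gives
     V(x + T s) <= V(x) - T (q |grad V(x)|^2 - h^2 (L/2) |f(x)|^2),
   where q = b (1 - L b / 2) > 0.  If V(x) >= eps/2 then |grad V(x)|^2 is bounded
   below by compactness and (A3), so the bracket is positive for small h; if
   V(x) < eps/2 then the increase is less than eps/2 for small h.  In both cases
   V(x + T s) < eps for T > 0, so the segment cannot leave U^eps: this is a
   continuity argument in T.
   Dividing by L requires L > 0, which holds because V would otherwise be concave
   along lines in U^eps, and this is incompatible with a nonempty compact zero
   set in the interior of U^eps. *)
Require Import Defs.
From HB Require Import structures.
From mathcomp Require Import all_boot all_order all_algebra.
From mathcomp Require Import all_classical all_reals all_analysis.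
From mathcomp Require Import ring lra.

Set Implicit Arguments.
Unset Strict Implicit.
Unset Printing Implicit Defensive.

Import Order.TTheory GRing.Theory Num.Theory.
Import numFieldNormedType.Exports.

Local Open Scope classical_set_scope.
Local Open Scope ring_scope.

(** * Euclidean inner product and norm *)

Lemma dotvC (R : realType) n (u v : 'rV[R]_n) : dotv u v = dotv v u.
Proof. by apply: eq_bigr => i _; rewrite mulrC. Qed.

Lemma dotvDr (R : realType) n (u v w : 'rV[R]_n) :
  dotv u (v + w) = dotv u v + dotv u w.
Proof. by rewrite -big_split; apply: eq_bigr => i _; rewrite mxE mulrDr. Qed.

Lemma dotvZr (R : realType) n (a : R) (u v : 'rV[R]_n) :
  dotv u (a *: v) = a * dotv u v.
Proof. by rewrite mulr_sumr; apply: eq_bigr => i _; rewrite mxE mulrCA. Qed.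

Lemma dotvDl (R : realType) n (u v w : 'rV[R]_n) :
  dotv (u + v) w = dotv u w + dotv v w.
Proof. by rewrite dotvC dotvDr !(dotvC w). Qed.

Lemma dotvZl (R : realType) n (a : R) (u v : 'rV[R]_n) :
  dotv (a *: u) v = a * dotv u v.
Proof. by rewrite dotvC dotvZr dotvC. Qed.

Lemma dotv_ge0 (R : realType) n (u : 'rV[R]_n) : 0 <= dotv u u.
Proof. by apply: sumr_ge0 => i _; rewrite -expr2 sqr_ge0. Qed.

Lemma dotv_eq0 (R : realType) n (u : 'rV[R]_n) : dotv u u = 0 -> u = 0.
Proof.
move=> u0; apply/rowP => i; rewrite mxE; apply/eqP.
have /psumr_eq0P : forall j : 'I_n, true -> 0 <= u 0 j * u 0 j.
  by move=> j _; rewrite -expr2 sqr_ge0.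
by move=> /(_ u0 i isT) /eqP; rewrite mulf_eq0 orbb.
Qed.

Lemma enorm_ge0 (R : realType) n (u : 'rV[R]_n) : 0 <= enorm u.
Proof. exact: sqrtr_ge0. Qed.

Lemma sqr_enorm (R : realType) n (u : 'rV[R]_n) : enorm u ^+ 2 = dotv u u.
Proof. by rewrite sqr_sqrtr // dotv_ge0. Qed.

Lemma enormZ (R : realType) n (a : R) (u : 'rV[R]_n) :
  enorm (a *: u) = `|a| * enorm u.
Proof.
by rewrite /enorm dotvZl dotvZr mulrA -expr2 sqrtrM ?sqr_ge0// sqrtr_sqr.
Qed.

(** Cauchy-Schwarz: the vector [|u|^2 v - <u,v> u] has squared norm [|u|^2 (|u|^2 |v|^2 - <u,v>^2)],
    which is nonnegative. *)
Lemma sqr_dotv_le (R : realType) n (u v : 'rV[R]_n) :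
  dotv u v ^+ 2 <= dotv u u * dotv v v.
Proof.
have [/dotv_eq0 ->|u0] := eqVneq (dotv u u) 0.
  by rewrite -(scale0r 0) !dotvZl !mul0r expr0n.
have ugt0 : 0 < dotv u u by rewrite lt_neqAle eq_sym u0 dotv_ge0.
have := dotv_ge0 (dotv u u *: v + (- dotv u v) *: u).
rewrite !(dotvDl, dotvDr, dotvZl, dotvZr) (dotvC v u) => h.
rewrite -subr_ge0 -(pmulr_rge0 _ ugt0); apply: le_trans h _.
by rewrite le_eqVlt; apply/orP; left; apply/eqP; ring.
Qed.

Lemma dotv_le_enorm (R : realType) n (u v : 'rV[R]_n) :
  dotv u v <= enorm u * enorm v.
Proof.
apply: le_trans (ler_norm _) _.
rewrite -ler_sqr ?nnegrE ?mulr_ge0 ?enorm_ge0//.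
by rewrite exprMn !sqr_enorm real_normK ?num_real// sqr_dotv_le.
Qed.

(** * The matrix 2-norm *)

(** An upper bound for [mx2norm] that is explicit in the entries: it shows that the suprema involved
    are finite. *)
Definition frobenius (R : realType) n (A : 'M[R]_n) : R :=
  Num.sqrt (\sum_i \sum_j A i j ^+ 2).

Lemma enorm_mul_le_frobenius (R : realType) n (A : 'M[R]_n) (u : 'rV[R]_n) :
  enorm u <= 1 -> enorm (u *m A^T) <= frobenius A.
Proof.
move=> u1; apply: ler_wsqrtr; apply: ler_sum => i _.
have -> : (u *m A^T) 0 i = dotv u (row i A).
  by rewrite !mxE; apply: eq_bigr => j _; rewrite !mxE.
rewrite -expr2; apply: le_trans (sqr_dotv_le _ _) _.
have -> : \sum_j A i j ^+ 2 = dotv (row i A) (row i A).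
  by apply: eq_bigr => j _; rewrite !mxE expr2.
by rewrite ler_piMl ?dotv_ge0// -sqr_enorm expr_le1 ?enorm_ge0.
Qed.

Lemma mx2norm_le_frobenius (R : realType) n (A : 'M[R]_n) :
  mx2norm A <= frobenius A.
Proof.
apply: ge_sup => [|_ [u /= u1 <-]]; last exact: enorm_mul_le_frobenius.
exists (enorm ((0 : 'rV[R]_n) *m A^T)), 0 => //=.
by rewrite /enorm /dotv big1 ?sqrtr0// => i _; rewrite mxE mul0r.
Qed.

Lemma enorm_mul_le (R : realType) n (A : 'M[R]_n) (u : 'rV[R]_n) :
  enorm (u *m A^T) <= mx2norm A * enorm u.
Proof.
have [u0|u0] := eqVneq (enorm u) 0.
  have -> : u = 0 by apply: dotv_eq0; rewrite -sqr_enorm u0 expr0n.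
  by rewrite mul0mx -(scale0r 0) enormZ normr0 mul0r mulr0.
have ugt0 : 0 < enorm u by rewrite lt_neqAle eq_sym u0 enorm_ge0.
(* After division by [enorm u], the left side is the norm of the image of a unit vector, hence a
   member of the set whose supremum is [mx2norm A]. *)
rewrite -ler_pdivrMr// mulrC -[X in X * _]gtr0_norm ?invr_gt0// -enormZ.
rewrite scalemxAl; apply: ub_le_sup.
  by exists (frobenius A) => _ [v /= v1 <-]; exact: enorm_mul_le_frobenius.
exists ((enorm u)^-1 *: u) => //=.
by rewrite enormZ gtr0_norm ?invr_gt0// mulVf.
Qed.

Lemma quadratic_form_le (R : realType) n (A : 'M[R]_n) (u : 'rV[R]_n) :
  dotv u (u *m A^T) <= mx2norm A * dotv u u.
Proof.
apply: le_trans (dotv_le_enorm _ _) _; rewrite -sqr_enorm expr2 mulrA mulrC.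
by rewrite ler_wpM2r ?enorm_ge0 ?enorm_mul_le.
Qed.

(** * Bounds on compact sets and continuity induction *)

(** The extreme value theorem, phrased so as to cover the empty set and to give a positive constant,
    by which one may divide. *)
Lemma compact_le (R : realType) (T : topologicalType) (K : set T) (g : T -> R) :
  compact K -> (forall x, K x -> {for x, continuous g}) ->
  exists2 c, 0 < c & forall x, K x -> g x <= c.
Proof.
move=> cK cg; have [K0|K0] := pselect (K !=set0); last first.
  by exists 1 => // x Kx; case: K0; exists x.
have [|a _ amax] := @compact_EVT_max _ _ g _ K0 cK.
  by apply: continuous_in_subspaceT => x /set_mem; exact: cg.
exists (`|g a| + 1) => [|x /mem_set /amax gxa]; first by rewrite ltr_pwDr.
by rewrite (le_trans gxa)// (le_trans (ler_norm _))// lerDl.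
Qed.

Lemma compact_ge_gt0 (R : realType) (T : topologicalType) (K : set T)
    (g : T -> R) :
  compact K -> (forall x, K x -> {for x, continuous g}) ->
  (forall x, K x -> 0 < g x) -> exists2 d, 0 < d & forall x, K x -> d <= g x.
Proof.
move=> cK cg gpos; have [K0|K0] := pselect (K !=set0); last first.
  by exists 1 => // x Kx; case: K0; exists x.
have [|a /set_mem Ka amin] := @compact_EVT_min _ _ g _ K0 cK.
  by apply: continuous_in_subspaceT => x /set_mem; exact: cg.
by exists (g a) => [|x /mem_set /amin//]; exact: gpos.
Qed.

(** If [B] fails somewhere, let [T] be the infimum of the failures. Then [B] holds on [[0, T)],
    hence at [T] by closedness, and the step carries it past [T], which contradicts the choice of
    [T]. *)
Lemma real_induction (R : realType) (B : set R) :
  closed B -> B 0 ->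
  (forall T, 0 <= T < 1 -> (forall t, 0 <= t <= T -> B t) ->
     \forall t \near T^'+, B t) ->
  forall t, 0 <= t <= 1 -> B t.
Proof.
move=> cB B0 step t0 /andP[t00 t01]; apply: contrapT => nB.
pose C := [set t | 0 <= t /\ ~ B t].
have Ct0 : C t0 by [].
have lbC : lbound C 0 by move=> t [].
have hC : has_inf C by split; [exists t0 | exists 0].
pose T := inf C.
have T0 : 0 <= T by apply: lb_le_inf => //; exists t0.
have Tt0 : T <= t0 by apply: ge_inf => //; exists 0.
have ltT t : 0 <= t < T -> B t.
  move=> /andP[tge0 tT]; apply: contrapT => nBt.
  by move: tT; rewrite ltNge => /negP; apply; apply: ge_inf; [exists 0 | split].
have BT : B T.
  have [->//|Tn0] := eqVneq T 0.
  have Tpos : 0 < T by rewrite lt_neqAle eq_sym Tn0.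
  apply: contrapT => nBT.
  have /nbhs_ballP[d /= d0 dB] : nbhs T (~` B).
    by apply: open_nbhs_nbhs; split => //; exact: closed_openC.
  (* This point is within [d] of [T] and lies in [[0, T)], so [B] both fails and holds there. *)
  have /= := dB (Num.max 0 (T - d / 2)).
  rewrite /ball /=; apply.
    have [h|h] := leP 0 (T - d / 2); first by rewrite opprB addrC subrK gtr0_norm; lra.
    by rewrite subr0 gtr0_norm //; lra.
  by apply: ltT; rewrite le_max lexx/= gt_max Tpos/=; lra.
have Tlt : T < t0.
  by rewrite lt_neqAle Tt0 andbT; apply/eqP => E; apply: nB; rewrite -E.
have /step : 0 <= T < 1 by rewrite T0/= (lt_le_trans Tlt).
case=> [t /andP[tge0]|d /= d0 dB].
  by rewrite le_eqVlt => /predU1P[->//|tT]; apply: ltT; rewrite tge0.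
(* Some failure [c] lies in [[T, T + d)], where [B] is already known to hold. *)
have [|c [c0 nBc] cT] := @inf_lt _ C (T + d) (ex_intro _ t0 Ct0).
  by rewrite ltrDl.
have Tc : T <= c by apply: ge_inf; [exists 0 | split].
have [E|Tnc] := eqVneq T c; first by apply: nBc; rewrite -E.
apply: nBc; apply: dB; last by rewrite lt_neqAle Tnc.
by rewrite /ball /= distrC ger0_norm; lra.
Qed.

(** * Calculus along lines and the second-order Taylor estimate *)

Lemma near_right_lt (R : realType) (g : R -> R) (a l : R) :
  is_derive a 1 g l -> l < 0 -> \forall t \near a^'+, g t < g a.
Proof.
move=> [dg <-] l0.
have /cvgr_lt /(_ _ l0) : h^-1 *: (g (h *: 1 + a) - g a) @[h --> 0^'] --> 'D_1 g a.
  exact: dg.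
case=> d /= d0 dB; exists d => //= t at_d at_.
have ta : 0 < t - a by rewrite subr_gt0.
have /= := dB (t - a); rewrite -[_ *: 1]/(_ * 1) mulr1 subrK.
rewrite -[_ *: _]/(_ * _) pmulr_rlt0 ?invr_gt0// subr_lt0; apply.
  by rewrite /ball /= sub0r normrN distrC.
by rewrite gt_eqF.
Qed.

Lemma derive_dotv_grad (R : realType) n (g : 'rV[R]_n -> R) (x v : 'rV[R]_n) :
  differentiable g x -> 'D_v g x = dotv v (grad g x).
Proof.
move=> dg; rewrite deriveE// {1}[v]row_sum_delta linear_sum.
by apply: eq_bigr => i _; rewrite linearZ /= !mxE deriveE.
Qed.

Lemma is_derive_line (R : realType) n (g : 'rV[R]_n -> R) (x s : 'rV[R]_n)
    (t : R) : differentiable g (x + t *: s) ->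
  is_derive t 1 (fun r => g (x + r *: s)) (dotv s (grad g (x + t *: s))).
Proof.
move=> dg.
(* The difference quotient of the restriction to the line is exactly the one defining the derivative
   of [g] in direction [s]. *)
have E : (fun h : R => h^-1 *: (g (x + (h *: 1 + t) *: s) - g (x + t *: s))) =
    (fun h : R => h^-1 *: (g (h *: s + (x + t *: s)) - g (x + t *: s))).
  apply/funext => h; congr (_ *: (g _ - _)).
  by rewrite scalerDl addrCA -[h *: 1]/(h * 1) mulr1.
split; first by rewrite /derivable E; exact: diff_derivable.
by rewrite -derive_dotv_grad// /derive E.
Qed.

Lemma ler_derive_segment (R : realType) (g dg : R -> R) (a b : R) :
  a <= b -> (forall t : R, a <= t <= b -> is_derive t 1 g (dg t)) ->
  (forall t : R, a <= t <= b -> dg t <= 0) -> g b <= g a.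
Proof.
move=> ab gd dg0.
have [t||c] := @MVT_segment R g dg a b ab.
- by rewrite in_itv/= => /andP[at_ tb]; apply: gd; rewrite !ltW.
- by apply: derivable_within_continuous => t; rewrite in_itv/= => /gd [].
rewrite in_itv/= => cab E; rewrite -subr_le0 E.
by rewrite mulr_le0_ge0 ?subr_ge0 ?dg0.
Qed.

(** Two monotonicity arguments replace a remainder formula. With [phi1] the derivative of [V] along
    the segment, [phi1 t - K t] is nonincreasing; hence so is [V (x + t s) - phi1 0 t - K t^2 / 2],
    and its values at 0 and 1 are compared. *)
Lemma taylor2_le (R : realType) n (U : set 'rV[R]_n) (V : 'rV[R]_n -> R)
    (x s : 'rV[R]_n) (K : R) :
  Ck_on 2 U V -> (forall t : R, 0 <= t <= 1 -> U (x + t *: s)) ->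
  (forall t : R, 0 <= t <= 1 ->
     dotv s (s *m (hessian V (x + t *: s))^T) <= K) ->
  V (x + s) <= V x + dotv s (grad V x) + K / 2.
Proof.
move=> [dV dDV] segU hK.
pose phi1 (t : R) := dotv s (grad V (x + t *: s)).
have dphi1 (t : R) : 0 <= t <= 1 ->
    is_derive t 1 phi1 (dotv s (s *m (hessian V (x + t *: s))^T)).
  move=> t01.
  (* Written as a finite sum of functions, [phi1] is differentiated term by term; exchanging the two
     sums then yields the Hessian form. *)
  have -> : phi1 = \sum_(j < n)
      (fun r : R => s 0 j *: 'D_(delta_mx 0 j) V (x + r *: s)).
    apply/funext => r; rewrite fct_sumE.
    by apply: eq_bigr => j _; rewrite mxE.
  have D j : is_derive t 1 (fun r : R => 'D_(delta_mx 0 j) V (x + r *: s))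
      (dotv s (grad ('D_(delta_mx 0 j) V) (x + t *: s))).
    by apply: is_derive_line; have [+ _] := dDV (delta_mx 0 j); apply; exact: segU.
  apply: is_derive_eq.
  rewrite /dotv; under eq_bigr do rewrite -[_ *: _]/(_ * _) mulr_sumr.
  rewrite exchange_big; apply: eq_bigr => i _; rewrite !mxE mulr_sumr.
  by apply: eq_bigr => j _; rewrite !mxE; ring.
have phi1_le (t : R) : 0 <= t <= 1 -> phi1 t - K * t <= phi1 0.
  move=> /andP[t0 t1].
  have := @ler_derive_segment _ (phi1 - (K \*: id))
    (fun r => dotv s (s *m (hessian V (x + r *: s))^T) - K *: 1) 0 t t0.
  rewrite -[(_ - _) 0]/(phi1 0 - K * 0) mulr0 subr0; apply.
    move=> r /andP[r0 rt]; apply: is_deriveB.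
    by apply: dphi1; rewrite r0 (le_trans rt).
  move=> r /andP[r0 rt]; rewrite -[_ *: 1]/(_ * 1) mulr1.
  by rewrite subr_le0 hK// r0 (le_trans rt).
have := @ler_derive_segment _
  ((fun r => V (x + r *: s)) - (phi1 0 \*: id) - (K / 2 \*: (id ^+ 2)))
  (fun r => phi1 r - phi1 0 *: 1 - K / 2 *: ((2 * r ^+ 1) *: 1)) 0 1 ler01.
rewrite -[(_ - _) 0]/(V (x + 0 *: s) - phi1 0 * 0 - K / 2 * (0 * 0)).
rewrite -[(_ - _) 1]/(V (x + 1 *: s) - phi1 0 * 1 - K / 2 * (1 * 1)).
have phi10 : phi1 0 = dotv s (grad V x) by rewrite /phi1 scale0r addr0.
rewrite !scale0r !scale1r !addr0 !mulr0 !mulr1 !subr0 => h.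
suff: V (x + s) - phi1 0 - K / 2 <= V x by rewrite phi10; lra.
apply: h => r r01.
  have : is_derive r 1 (fun r => V (x + r *: s)) (phi1 r).
    by apply: is_derive_line; apply: dV; exact: segU.
  move=> D; apply: is_deriveB.
have := phi1_le r r01; rewrite -[phi1 0 *: 1]/(_ * 1).
rewrite -[K / 2 *: _]/(K / 2 * (2 * r ^+ 1 * 1)) expr1.
lra.
Qed.

(** * Topology of sublevel sets and the Hessian bound *)

(** Since [g] is continuous only at points of [K], the preimage alone may fail to be closed. A limit
    point of the intersection first lands in the closed set [K]; continuity there then puts its
    value in [D]. *)
Lemma compactI_preimage (R : realType) (T : topologicalType) (K : set T)
    (g : T -> R) (D : set R) :
  hausdorff_space T -> compact K -> (forall x, K x -> {for x, continuous g}) ->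
  closed D -> compact (K `&` g @^-1` D).
Proof.
move=> hT cK cg cD; apply: (subclosed_compact _ cK); last exact: subIsetl.
move=> x clx; have Kx : K x.
  apply: (compact_closed hT cK) => B /clx [y [[Ky _] By]]; by exists y.
split=> //; apply: cD => N /(cg x Kx) /clx [y [[_ Dy] Ny]].
by exists (g y).
Qed.

Lemma continuous_sum (R : realType) (T : topologicalType) (I : finType)
    (g : I -> T -> R) (x : T) :
  (forall i, {for x, continuous (g i)}) ->
  {for x, continuous (fun y => \sum_i g i y)}.
Proof.
move=> cg; apply: cvg_big => [|i _]; [exact: add_continuous | exact: cg].
Qed.

Lemma continuous_dotv (R : realType) (T : topologicalType) n
    (u : T -> 'rV[R]_n) (x : T) :
  (forall i, {for x, continuous (fun y => u y 0 i)}) ->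
  {for x, continuous (fun y => dotv (u y) (u y))}.
Proof. by move=> cu; apply: continuous_sum => i; apply: continuousM. Qed.

Lemma line_continuous (R : realType) n (x s : 'rV[R]_n) :
  continuous (fun t : R => x + t *: s).
Proof.
by move=> t; apply: cvgD; [exact: cvg_cst | exact: scalel_continuous].
Qed.

Lemma Ck2_continuous (R : realType) n (U : set 'rV[R]_n) (V : 'rV[R]_n -> R) x :
  Ck_on 2 U V -> U x -> {for x, continuous V}.
Proof. by move=> [dV _] /dV; exact: differentiable_continuous. Qed.

Lemma sqr_grad_continuous (R : realType) n (U : set 'rV[R]_n)
    (V : 'rV[R]_n -> R) x : Ck_on 2 U V -> U x ->
  {for x, continuous (fun y => dotv (grad V y) (grad V y))}.
Proof.
move=> [_ dDV] Ux; apply: continuous_dotv => i.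
rewrite (_ : (fun _ => _) = 'D_(delta_mx 0 i) V); last first.
  by apply/funext => y; rewrite mxE.
by have [+ _] := dDV (delta_mx 0 i) => /(_ x Ux); exact: differentiable_continuous.
Qed.

Lemma sublevelP (R : realType) n (U : set 'rV[R]_n) (V : 'rV[R]_n -> R) c x :
  (forall y, U y -> 0 <= V y) -> sublevel U V c x <-> U x /\ V x <= c.
Proof.
rewrite /sublevel /= in_itv/= => V0; split=> [[Ux /andP[]]//|[Ux Vx]].
by rewrite V0.
Qed.

Lemma sublevel_nbhs (R : realType) n (U : set 'rV[R]_n) (V : 'rV[R]_n -> R) c x :
  (forall y, U y -> 0 <= V y) -> open U -> U x -> {for x, continuous V} ->
  V x < c -> \forall y \near x, sublevel U V c y.
Proof.
move=> V0 oU Ux cV Vx; near=> y; apply/sublevelP => //; split.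
  by near: y; exact: open_nbhs_nbhs.
by apply: ltW; near: y; exact: (cvgr_lt (V x)).
Unshelve. all: by end_near. Qed.

Lemma sublevel_compact (R : realType) n (U : set 'rV[R]_n) (V : 'rV[R]_n -> R)
    (b c : R) :
  (forall x, U x -> {for x, continuous V}) -> c <= b ->
  compact (sublevel U V b) -> compact (sublevel U V c).
Proof.
move=> cV cb cK; have -> : sublevel U V c = sublevel U V b `&` V @^-1` `[0, c].
  apply/seteqP; split=> x /=; rewrite /sublevel /= !in_itv/=; last by case=> [[]].
  by move=> [Ux /andP[V0 Vx]]; split; [split|]; rewrite ?V0 ?Vx ?(le_trans Vx cb).
apply: compactI_preimage => //.
- by move=> x [Ux _]; exact: cV.
- exact: interval_closed.
Qed.

(** The Hessian entries are continuous, so their sum of squares is bounded on the compact sublevel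
    set; this makes [hess_sup] a genuine supremum. *)
Lemma mx2norm_le_hess_sup (R : realType) n (U : set 'rV[R]_n)
    (V : 'rV[R]_n -> R) (c : R) x :
  Ck_on 2 U V -> compact (sublevel U V c) -> sublevel U V c x ->
  mx2norm (hessian V x) <= hess_sup U V c.
Proof.
move=> [_ dDV] cK Kx.
have [B _ hB] : exists2 B, 0 < B & forall y, sublevel U V c y ->
    \sum_i \sum_j hessian V y i j ^+ 2 <= B.
  apply: compact_le cK _ => y [Uy _].
  apply: continuous_sum => i; apply: continuous_sum => j.
  rewrite (_ : (fun _ => _) = (fun z => 'D_(delta_mx 0 i) ('D_(delta_mx 0 j) V) z *
      'D_(delta_mx 0 i) ('D_(delta_mx 0 j) V) z)); last first.
    by apply/funext => z; rewrite mxE expr2.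
  by apply: continuousM; have [_ +] := dDV (delta_mx 0 j); apply.
apply: ub_le_sup; last by exists x.
exists (Num.sqrt B) => _ [y Ky <-]; apply: le_trans (mx2norm_le_frobenius _) _.
by rewrite ler_wsqrtr ?hB.
Qed.

Lemma taylor2_sublevel_le (R : realType) n (U : set 'rV[R]_n)
    (V : 'rV[R]_n -> R) (c : R) (x s : 'rV[R]_n) :
  Ck_on 2 U V -> compact (sublevel U V c) ->
  (forall t : R, 0 <= t <= 1 -> sublevel U V c (x + t *: s)) ->
  V (x + s) <= V x + dotv s (grad V x) + hess_sup U V c * dotv s s / 2.
Proof.
move=> C2 cK seg; apply: (taylor2_le C2) => t /seg; first by case.
move=> Kt; apply: le_trans (quadratic_form_le _ _) _.
by rewrite ler_wpM2r ?dotv_ge0 ?mx2norm_le_hess_sup.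
Qed.

(* If the supremum were not positive, V would be concave near a zero maximizing
   the first coordinate, so it would vanish on both sides of that zero. *)
Lemma hess_sup_gt0 (R : realType) n (U : set 'rV[R]_n) (V : 'rV[R]_n -> R)
    (c : R) x :
  (0 < n)%N -> open U -> Ck_on 2 U V -> (forall y, U y -> 0 <= V y) ->
  0 < c -> compact (sublevel U V c) -> U x -> V x = 0 -> 0 < hess_sup U V c.
Proof.
case: n U V x => // n U V x _ oU C2 V0 c0 cK Ux Vx0.
rewrite ltNge; apply/negP => L0.
have cV y : U y -> {for y, continuous V} by exact: Ck2_continuous.
have cZ := sublevel_compact cV (ltW c0) cK.
have [||a /set_mem /(sublevelP _ _ V0) [Ua Va0] amax] :=
    @compact_EVT_max _ _ (fun y : 'rV[R]_n.+1 => y 0 ord0) _ _ cZ.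
- by exists x; apply/sublevelP => //; rewrite Vx0.
- by apply: continuous_subspaceT; exact: coord_continuous.
have Va : V a = 0 by apply/eqP; rewrite eq_le Va0 V0.
pose s : 'rV[R]_n.+1 := delta_mx 0 ord0.
have : \forall t \near (0 : R), sublevel U V c (a + t *: s).
  apply: (@line_continuous _ _ a s 0 (sublevel U V c)).
  rewrite scale0r addr0.
  by apply: sublevel_nbhs => //; [exact: cV | rewrite Va].
move=> /nbhs_ballP[d /= d0 dK].
have hd (e : R) : `|e| < d -> V (a + e *: s) <= e * dotv s (grad V a).
  move=> ed; have := @taylor2_sublevel_le _ _ U V c a (e *: s) C2 cK.
  rewrite Va add0r !dotvZl => h; have {h} := h _.
  have K0 : hess_sup U V c * (e * dotv s (e *: s)) / 2 <= 0.
    rewrite dotvZr (mulrA e) -expr2 pmulr_lle0 ?invr_gt0//.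
    by rewrite mulr_le0_ge0// mulr_ge0 ?sqr_ge0 ?dotv_ge0.
  move=> h; suff : V (a + e *: s) <=
      e * dotv s (grad V a) + hess_sup U V c * (e * dotv s (e *: s)) / 2 by lra.
  apply: h => t /andP[t0 t1]; rewrite scalerA; apply: dK.
  rewrite /ball /= sub0r normrN normrM ger0_norm//.
  by rewrite (le_lt_trans _ ed)// ler_piMl.
have d2 : `|d / 2| < d by rewrite gtr0_norm; lra.
have Nd2 : `|- (d / 2)| < d by rewrite normrN.
have inU (e : R) : `|e| < d -> U (a + e *: s).
  move=> ed; have [] // : sublevel U V c (a + e *: s).
  by apply: dK; rewrite /ball /= sub0r normrN.
have := amax (a + (d / 2) *: s).
rewrite !mxE !eqxx mulr1 leNgt ltrDl divr_gt0//.
suff -> : a + (d / 2) *: s \in sublevel U V 0 by move=> /(_ isT).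
apply/mem_set/sublevelP => //; split; first exact: inU.
(* Nonnegativity of [V] at [-d/2] forces the slope to be at most 0, so [V] vanishes at [+d/2], where
   the first coordinate exceeds its maximum. *)
have := hd _ d2; have := hd _ Nd2; have := V0 _ (inU _ Nd2).
lra.
Qed.

(** * Confinement of the Euler segments to the sublevel set *)

Lemma segment_in_sublevel (R : realType) n (U : set 'rV[R]_n)
    (V : 'rV[R]_n -> R) (c : R) (x s : 'rV[R]_n) :
  open U -> (forall y, U y -> 0 <= V y) ->
  (forall y, U y -> differentiable V y) -> closed (sublevel U V c) ->
  sublevel U V c x -> V x < c \/ dotv s (grad V x) < 0 ->
  (forall T : R, 0 < T <= 1 ->
     (forall t : R, 0 <= t <= T -> sublevel U V c (x + t *: s)) ->
     V (x + T *: s) < c) ->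
  forall t : R, 0 <= t <= 1 -> sublevel U V c (x + t *: s).
Proof.
move=> oU V0 dV clK Kx start descent.
have [Ux Vxc] := (sublevelP c x V0).1 Kx.
have extend (T : R) : U (x + T *: s) -> V (x + T *: s) < c ->
    \forall t \near T^'+, sublevel U V c (x + t *: s).
  move=> UT VT; apply: cvg_within.
  apply: (@line_continuous _ _ x s T (sublevel U V c)).
  by apply: sublevel_nbhs => //; apply: differentiable_continuous; exact: dV.
apply: (@real_induction _ (fun t => sublevel U V c (x + t *: s))).
- exact: ((continuous_closedP _).1 (@line_continuous _ _ x s)).
- by rewrite scale0r addr0.
move=> T /andP[T0 T1] seg.
have [UT _] : sublevel U V c (x + T *: s) by apply: seg; rewrite T0 lexx.
(* For [T > 0] the descent hypothesis gives room below [c]. At [T = 0] the point may lie on the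
   level [c], and the negative initial slope takes over. *)
move: T0; rewrite le_eqVlt => /predU1P[T0|T0]; last first.
  by apply: extend => //; apply: descent => //; rewrite T0 ltW.
subst T; case: start => [Vx|gx].
  by apply: extend => //; rewrite scale0r addr0.
have dx0 : is_derive (0 : R) 1 (fun t : R => V (x + t *: s)) (dotv s (grad V x)).
  by rewrite -[in grad V x](addr0 x) -(scale0r s); apply: is_derive_line; exact: dV.
have Ut : \forall t \near 0^'+, U (x + t *: s).
  apply: cvg_within; apply: (@line_continuous _ _ x s 0 U).
  exact: open_nbhs_nbhs.
have Vt := near_right_lt dx0 gx; near=> t; apply/sublevelP => //; split.
  by near: t.
apply: le_trans Vxc; rewrite -[in leRHS](addr0 x) -(scale0r s); apply: ltW.
by near: t.
Unshelve. all: by end_near. Qed.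

(** Orthogonality removes the cross terms in [f] and [grad V] from both the linear and the quadratic
    part. The fraction [T] allows use on an initial piece of the step; [T = 1] gives the bound of
    [taylor_bound]. *)
Lemma euler_taylor_le (R : realType) n (U : set 'rV[R]_n) (V : 'rV[R]_n -> R)
    (f : 'rV[R]_n -> 'rV[R]_n) (c h b T : R) (x : 'rV[R]_n) :
  let s := h *: f x - b *: grad V x in
  Ck_on 2 U V -> compact (sublevel U V c) -> dotv (grad V x) (f x) = 0 ->
  0 <= T -> (forall t : R, 0 <= t <= T -> sublevel U V c (x + t *: s)) ->
  V (x + T *: s) <=
    V x + (- (T * b) + hess_sup U V c / 2 * (T * b) ^+ 2) *
            dotv (grad V x) (grad V x)
        + (T * h) ^+ 2 * hess_sup U V c / 2 * dotv (f x) (f x).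
Proof.
move=> s C2 cK orth T0 seg.
have := @taylor2_sublevel_le _ _ U V c x (T *: s) C2 cK.
have -> : dotv (T *: s) (grad V x) = - (T * b) * dotv (grad V x) (grad V x).
  rewrite /s -scaleNr !(dotvZl, dotvDl) (dotvC (f x)) orth; ring.
have -> : dotv (T *: s) (T *: s) = (T * b) ^+ 2 * dotv (grad V x) (grad V x)
    + (T * h) ^+ 2 * dotv (f x) (f x).
  rewrite /s -scaleNr !(dotvZl, dotvZr, dotvDl, dotvDr) (dotvC (f x) (grad V x)).
  by rewrite orth; ring.
move=> H; apply: le_trans (H _) _; last by rewrite le_eqVlt; apply/orP; left; apply/eqP; field.
move=> t /andP[t0 t1]; rewrite scalerA; apply: seg.
by rewrite mulr_ge0//= ler_piMl.
Qed.

Lemma euler_sweep_subset (R : realType) n (U : set 'rV[R]_n)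
    (V : 'rV[R]_n -> R) (f : 'rV[R]_n -> 'rV[R]_n) (c b : R) :
  open U -> (forall y, U y -> 0 <= V y) -> Ck_on 2 U V ->
  (forall x, U x -> {for x, continuous f}) ->
  (forall x, U x -> dotv (grad V x) (f x) = 0) ->
  0 < c -> compact (sublevel U V c) ->
  (forall x, sublevel U V c x -> grad V x = 0 -> V x = 0) ->
  0 < hess_sup U V c -> 0 < b < 2 / hess_sup U V c ->
  exists2 hb : R, 0 < hb & forall h : R, 0 < h < hb ->
    euler_sweep f V (sublevel U V c) h (b / h) `<=` sublevel U V c.
Proof.
set K := sublevel U V c; set L := hess_sup U V c.
move=> oU V0 C2 cf orth c0 cK crit L0 /andP[b0 bL].
have hT := @norm_hausdorff R 'rV[R]_n.
have cV y : U y -> {for y, continuous V} by exact: Ck2_continuous.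
have [C C0 fC] : exists2 C, 0 < C & forall x, K x -> dotv (f x) (f x) <= C.
  apply: compact_le cK _ => x [Ux _]; apply: continuous_dotv => i.
  apply: (@continuous_comp _ _ _ f (fun M : 'rV[R]_n => M 0 i)); first exact: cf.
  exact: coord_continuous.
(* On the compact layer where [V] is at least [c / 2], the gradient has no zero by [crit]. *)
have [d d0 gd] : exists2 d, 0 < d & forall x, (K `&` V @^-1` `[c / 2, +oo[) x ->
    d <= dotv (grad V x) (grad V x).
  apply: compact_ge_gt0.
  - apply: compactI_preimage => //; last exact: interval_closed.
    by move=> x [Ux _]; exact: cV.
  - by move=> x [[Ux _] _]; exact: sqr_grad_continuous C2 Ux.
  move=> x [Kx /=]; rewrite in_itv/= andbT => Vx.
  rewrite lt_neqAle dotv_ge0 andbT eq_sym; apply/eqP => /dotv_eq0 /(crit x Kx) E.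
  by move: Vx; rewrite E; lra.
(* The coefficient of the guaranteed decrease, positive exactly because [b < 2 / L]. *)
pose q := b * (1 - L * b / 2).
have q0 : 0 < q.
  by rewrite mulr_gt0// subr_gt0; move: bL; rewrite ltr_pdivlMr//; lra.
(* The allowance for the [f] term: below [c / 2] for points deep inside, below [q * d] for points of
   the outer layer. *)
pose mu := Num.min (c / 2) (q * d).
have mu0 : 0 < mu by rewrite lt_min divr_gt0//= mulr_gt0.
have LC0 : 0 < L * C by exact: mulr_gt0.
(* The cap 1 gives [h^2 <= h], so a condition linear in [h] suffices. *)
exists (Num.min 1 (mu / (L * C))) => [|h /andP[h0]].
  by rewrite lt_min ltr01 divr_gt0.
rewrite lt_min ltr_pdivlMr// => /andP[h1 hmu].
have h2 : h ^+ 2 * L / 2 * C < mu.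
  apply: le_lt_trans hmu.
  have : h ^+ 2 * (L * C) <= h * (L * C).
    by rewrite ler_wpM2r ?(ltW LC0)// expr2 ler_piMl// ltW.
  have : 0 <= h ^+ 2 * (L * C) by rewrite mulr_ge0 ?sqr_ge0 ?(ltW LC0).
  lra.
move: h2; rewrite lt_min => /andP[hc hqd].
move=> _ [x [t [Kx t01 ->]]].
have [Ux Vx] := (sublevelP c x V0).1 Kx.
pose s := h *: f x - b *: grad V x.
(* Since [h * (b / h) = b], the gradient part of the step does not shrink with [h]. *)
have -> : (t * h) *: (f x - (b / h) *: grad V x) = t *: s.
  rewrite -scalerA; congr (_ *: _); rewrite scalerBr scalerA mulrCA divff ?mulr1//.
  by rewrite gt_eqF.
set G := dotv (grad V x) (grad V x).
have G0 : 0 <= G by exact: dotv_ge0.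
have Gd : c / 2 <= V x -> d <= G.
  by move=> cVx; apply: gd; split => //=; rewrite in_itv/= cVx.
apply: segment_in_sublevel t01 => //.
- by case: C2.
- exact: compact_closed hT cK.
- move: Vx; rewrite le_eqVlt => /predU1P[Vx|]; [right | by left].
  rewrite /s -scaleNr !(dotvZl, dotvDl) (dotvC (f x)) orth// mulr0 add0r mulNr.
  rewrite oppr_lt0 mulr_gt0// (lt_le_trans d0)// Gd// Vx; lra.
move=> T /andP[T0 T1] seg.
have := euler_taylor_le C2 cK (orth _ Ux) (ltW T0) seg.
rewrite -/L -/G.
have F0 := dotv_ge0 (f x); have FC := fC x Kx.
move: (dotv (f x) (f x)) F0 FC => F F0 FC.
have HF : h ^+ 2 * L / 2 * F <= h ^+ 2 * L / 2 * C.
  by rewrite ler_wpM2l// !mulr_ge0 ?invr_ge0 ?sqr_ge0// ltW.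
have HF0 : 0 <= h ^+ 2 * L / 2 * F.
  by rewrite !mulr_ge0 ?invr_ge0 ?sqr_ge0// ltW.
(* T ^+ 2 <= T on [0, 1] makes the bound linear in T. *)
have TT : T ^+ 2 <= T by rewrite expr2 ler_piMl// ltW.
have ET : (T * h) ^+ 2 * L / 2 * F <= T * (h ^+ 2 * L / 2 * F).
  have -> : (T * h) ^+ 2 * L / 2 * F = T ^+ 2 * (h ^+ 2 * L / 2 * F) by ring.
  exact: ler_wpM2r.
have EG : (- (T * b) + L / 2 * (T * b) ^+ 2) * G <= - (T * (q * G)).
  have : T ^+ 2 * (L / 2 * b ^+ 2 * G) <= T * (L / 2 * b ^+ 2 * G).
    by apply: ler_wpM2r => //; rewrite !mulr_ge0 ?invr_ge0 ?sqr_ge0// ltW.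
  rewrite /q; lra.
move=> H; apply: le_lt_trans H _.
(* In the outer layer the gradient decrease strictly beats the [f] term; deeper inside, the [f] term
   is smaller than the remaining gap to [c]. *)
have [/Gd dG|Vc] := leP (c / 2) (V x).
  have qG : q * d <= q * G by rewrite ler_pM2l.
  have : T * (h ^+ 2 * L / 2 * F) < T * (q * G).
    by rewrite ltr_pM2l//; lra.
  lra.
have : T * (h ^+ 2 * L / 2 * F) <= h ^+ 2 * L / 2 * F by rewrite ler_piMl.
have : 0 <= T * (q * G) by apply: mulr_ge0 (ltW T0) (mulr_ge0 (ltW q0) G0).
lra.
Qed.

(** * The optimal gain and the final assembly *)

(** Completing the square: the coefficient of [|grad V|^2] equals its value at [1/L] plus
    [(L/2) (b - 1/L)^2]. *)
Lemma taylor_bound_min (R : realType) n (f : 'rV[R]_n -> 'rV[R]_n)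
    (V : 'rV[R]_n -> R) (L h : R) (x : 'rV[R]_n) (b : R) :
  0 < L -> taylor_bound f V L h x L^-1 <= taylor_bound f V L h x b.
Proof.
move=> L0; rewrite /taylor_bound lerD2r lerD2l ler_wpM2r ?sqr_ge0//.
have -> : - b + L / 2 * b ^+ 2 =
    (- L^-1 + L / 2 * L^-1 ^+ 2) + L / 2 * (b - L^-1) ^+ 2.
  by field; rewrite gt_eqF.
by rewrite lerDl mulr_ge0 ?sqr_ge0// divr_ge0// ltW.
Qed.

Theorem theorem3 (R : realType) (n m l : nat) (n_gt0 : (0 < n)%N)
  (M U : set 'rV[R]_n) (xI : 'rV[R]_n)
  (f : 'rV[R]_n -> 'rV[R]_n) (F : 'I_l -> 'rV[R]_n -> R)
  (V : 'rV[R]_n -> R) (nu eps : R)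
  (M_manifold : submanifold m M) (M_xI : M xI)
  (U_open : open U) (M_sub_U : M `<=` U)
  (f_smooth : smooth_on U f) (F_smooth : forall j, smooth_on U (F j))
  (f_tangent : forall x, M x -> tangent M x (f x))
  (f_global : forall x0, M x0 ->
     exists gamma, global_solution M f gamma /\ gamma 0 = x0)
  (F_integral : forall j, first_integral M f (F j))
  (V_ge0 : forall x, U x -> 0 <= V x)
  (V_analytic : analytic_on U V)
  (V_zero : U `&` V @^-1` [set 0] =
     [set x | [/\ U x, M x & forall j, F j x = F j xI]])
  (A1 : forall x, U x -> dotv (grad V x) (f x) = 0)
  (nu_gt0 : 0 < nu)
  (A2 : compact (sublevel U V nu))
  (A3 : forall x, sublevel U V nu x -> grad V x = 0 -> V x = 0)
  (eps_bounds : 0 < eps < nu) :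
  let Ue := sublevel U V eps in
  let L := hess_sup U V eps in
  (forall beta : R, 0 < beta < 2 / L ->
     exists2 hbeta : R, 0 < hbeta & forall h : R, 0 < h < hbeta ->
       [/\ euler_sweep f V Ue h (beta / h) `<=` Ue,
           euler_sweep f V Ue h (beta / h) = Ue &
           positively_invariant Ue (euler_step f V h (beta / h))]) /\
  (forall h alpha : R, 0 < h -> 0 < alpha ->
     euler_sweep f V Ue h alpha `<=` Ue ->
     forall x, Ue x ->
       [/\ V (euler_step f V h alpha x) <= taylor_bound f V L h x (h * alpha),
           forall beta : R, taylor_bound f V L h x L^-1 <=
                        taylor_bound f V L h x beta &
           h * (h * L)^-1 = L^-1]) /\
  (exists2 h0 : R, 0 < h0 & forall h : R, 0 < h < h0 ->
     [/\ 0 < (h * L)^-1,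
         euler_sweep f V Ue h (h * L)^-1 `<=` Ue &
         forall alpha : R, 0 < alpha -> euler_sweep f V Ue h alpha `<=` Ue ->
           forall x, Ue x ->
             taylor_bound f V L h x (h * (h * L)^-1) <=
             taylor_bound f V L h x (h * alpha)]).
Proof.
move=> Ue L; have /andP[eps0 epsnu] := eps_bounds.
have C2 : Ck_on 2 U V by have [+ _] := V_analytic; apply.
have cUe : compact (sublevel U V eps).
  apply: sublevel_compact (ltW epsnu) A2 => x; exact: Ck2_continuous C2.
have crit x : sublevel U V eps x -> grad V x = 0 -> V x = 0.
  move=> /(sublevelP _ _ V_ge0) [Ux Vx]; apply: A3; apply/sublevelP => //.
  by split=> //; exact: le_trans Vx (ltW epsnu).
have L0 : 0 < L.
  (* The initial point [xI] is the zero of [V] from which positivity of [L] is derived. *)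
  have [UxI VxI] : (U `&` V @^-1` [set 0]) xI.
    by rewrite V_zero; split=> //; exact: M_sub_U.
  exact: hess_sup_gt0 n_gt0 U_open C2 V_ge0 eps0 cUe UxI VxI.
have sweep b := euler_sweep_subset U_open V_ge0 C2 (f_smooth 0) A1 eps0 cUe
  crit L0 (b := b).
have gainE h : 0 < h -> h * (h * L)^-1 = L^-1.
  by move=> h0; field; rewrite !gt_eqF.
split; [|split].
- move=> b /sweep [hb hb0 sub]; exists hb => // h hhb.
  have subh := sub h hhb; split=> //.
    (* Taking [t = 0] shows that the sweep contains [Ue]; below, [t = 1] is the Euler step. *)
    apply/seteqP; split=> // x Ux; exists x, 0; split=> //.
      by rewrite lexx ler01.
    by rewrite mul0r scale0r addr0.
  move=> x Ux; apply: subh; exists x, 1; split=> //; first by rewrite ler01 lexx.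
  by rewrite mul1r.
- move=> h alpha h0 alpha0 adm x Ux; split; last exact: gainE.
    (* The whole step, [T = 1]; admissibility says precisely that its segment stays in [Ue]. *)
    have := @euler_taylor_le _ _ U V f eps h (h * alpha) 1 x C2 cUe.
    rewrite -scalerA -scalerBr !mul1r scale1r /taylor_bound !sqr_enorm; apply.
    + by apply: A1; case: Ux.
    + exact: ler01.
    by move=> t t01; rewrite scalerA; apply: adm; exists x, t.
  by move=> b; exact: taylor_bound_min.
(* The value [1/L] lies in [(0, 2/L)], so admissibility for small [h] is an instance of the sweep
   inclusion. *)
have /sweep [h0 h00 sub] : 0 < L^-1 < 2 / L.
  by rewrite invr_gt0 L0/= -{1}[L^-1]mul1r ltr_pM2r ?invr_gt0// ltr1n.
exists h0 => // h hh; have /andP[hgt0 _] := hh.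
have E : (h * L)^-1 = L^-1 / h by rewrite invfM mulrC.
split; first by rewrite invr_gt0 mulr_gt0.
  by rewrite E; exact: sub.
by move=> alpha _ _ x _; rewrite gainE//; exact: taylor_bound_min.
Qed.
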